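(* Assume that the system $x(t+1)=f(x(t),u(t))$ fulfills Uniform Incremental Controllability Continuous in Cost. Then, for any continuous function $\psi:\mathbb{X}\to\mathbb{R}$, the sequence $\{T^k\psi\}_{k=0}^{+\infty}$ is equicontinuous.
   Context: Setting. $\mathbb{X}\subset\mathbb{R}^n$ is a nonempty compact set, $\mathbb{Z}\subset\mathbb{X}\times\mathbb{R}^m$ is compact, $f:\mathbb{Z}\to\mathbb{X}$ and $\ell:\mathbb{Z}\to\mathbb{R}$ are continuous. For $x\in\mathbb{X}$, $\mathbb{U}(x):=\{u\in\mathbb{R}^m:(x,u)\in\mathbb{Z}\}$ is nonempty, and $f(x,u)\in\mathbb{X}$ for all $u\in\mathbb{U}(x)$; the set-valued map $\mathbb{U}(\cdot)$ is upper semicontinuous. $\mathcal{C}(\mathbb{X})$ is the set of continuous functions $\mathbb{X}\to\mathbb{R}$. Bellman operator: $T\psi(x):=\min_{u\in\mathbb{U}(x)}[\ell(x,u)+\psi(f(x,u))]$; it is a standing assumption that $T$ maps $\mathcal{C}(\mathbb{X})$ into $\mathcal{C}(\mathbb{X})$. $T^k$ denotes the $k$-th iterate. For an input sequence $\mathbf{u}=\{u(t)\}$, $\phi(t,x,\mathbf{u})$ denotes the state at time $t$ of $x(t+1)=f(x(t),u(t))$ with $x(0)=x$. For $N\in\mathbb{N}$, $\mathbb{U}_N(x):=\{\mathbf{u}=\{u(t)\}_{t=0}^{N-1}\in\mathbb{R}^{mN}:(\phi(t,x,\mathbf{u}),u(t))\in\mathbb{Z}\ \forall t\in\{0,\dots,N-1\}\}$,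 and $J_N(x,\mathbf{u}):=\sum_{t=0}^{N-1}\ell(\phi(t,x,\mathbf{u}),u(t))$ for $\mathbf{u}\in\mathbb{U}_N(x)$. The system fulfills Uniform Incremental Controllability Continuous in Cost if there exist $N\in\mathbb{N}$ and a class $\mathcal{K}_\infty$ function $\delta$ such that for all $x_1,x_2\in\mathbb{X}$ and all $\mathbf{u}_1\in\mathbb{U}_N(x_1)$ there exists $\mathbf{u}_2\in\mathbb{U}_N(x_2)$ with $\phi(N,x_1,\mathbf{u}_1)=\phi(N,x_2,\mathbf{u}_2)$ and $|J_N(x_1,\mathbf{u}_1)-J_N(x_2,\mathbf{u}_2)|\le\delta(|x_1-x_2|)$. A sequence of functions $\psi_k:\mathbb{X}\to\mathbb{R}$ is equicontinuous if there is $\gamma\in\mathcal{K}_\infty$ such that $|\psi_k(x_1)-\psi_k(x_2)|\le\gamma(|x_1-x_2|)$ for all $k\in\mathbb{N}$ and all $x_1,x_2\in\mathbb{X}$. $\mathcal{K}_\infty$ is the class of continuous, strictly increasing, unbounded functions $[0,\infty)\to[0,\infty)$ vanishing at $0$. *)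

(* Defs.v *)
From HB Require Import structures.
From mathcomp Require Import all_boot all_order all_algebra.
From mathcomp Require Import all_classical all_reals all_analysis.

Set Implicit Arguments.
Unset Strict Implicit.
Unset Printing Implicit Defensive.

Import Order.TTheory GRing.Theory Num.Theory.
Import numFieldNormedType.Exports.

Local Open Scope classical_set_scope.
Local Open Scope ring_scope.

(* The library's norm on 'rV[R]_n is the sup norm. It induces the same topology
   as the Euclidean norm, so it is used for compactness and continuity, while
   quantitative bounds are stated with the Euclidean norm. *)
Definition euclidean_norm (R : realType) (n : nat) (x : 'rV[R]_n) : R :=
  Num.sqrt (\sum_(i < n) x 0 i ^+ 2).

(* Maps with domain [0, +oo[ are represented by total functions on R, whose
   values at negative arguments are irrelevant. *)
Definition class_Kinfty (R : realType) (gamma : R -> R) : Prop :=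
  [/\ set_fun `[0, +oo[%classic `[0, +oo[%classic gamma,
      {within `[0, +oo[%classic, continuous gamma},
      {in `[0, +oo[ &, {homo gamma : s t / s < t}},
      forall M, exists2 s, 0 <= s & M < gamma s
    & gamma 0 = 0].

(* The least element of A; it is the junk value 0 when A has none. *)
Definition minimum (R : realType) (A : set R) : R := xget 0 (A `&` lbound A).

Definition upper_semicontinuous_on (T V : topologicalType) (X : set T)
    (U : T -> set V) : Prop :=
  forall x, X x -> forall W : set V, open W -> U x `<=` W ->
    \forall y \near x, X y -> U y `<=` W.

(* A sequence of functions on X; values outside X are irrelevant. *)
Definition equicontinuous_seq (R : realType) (n : nat) (X : set 'rV[R]_n)
    (psi : nat -> 'rV[R]_n -> R) : Prop :=
  exists2 gamma : R -> R, class_Kinfty gamma &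
    forall k x1 x2, X x1 -> X x2 ->
      `|psi k x1 - psi k x2| <= gamma (euclidean_norm (x1 - x2)).

(* Maps with domain Z (f, l) or X (psi) are represented by total functions that
   are only ever constrained, and only matter, on Z or X. *)
Section ControlSystem.
Context {R : realType} {n m : nat}.
Variable Z : set ('rV[R]_n * 'rV[R]_m).
Variable f : 'rV[R]_n * 'rV[R]_m -> 'rV[R]_n.
Variable l : 'rV[R]_n * 'rV[R]_m -> R.

Definition inputs (x : 'rV[R]_n) : set 'rV[R]_m := [set u | Z (x, u)].

Definition bellman (psi : 'rV[R]_n -> R) (x : 'rV[R]_n) : R :=
  minimum [set l (x, u) + psi (f (x, u)) | u in inputs x].

Fixpoint trajectory (t : nat) (x : 'rV[R]_n) (u : seq 'rV[R]_m) : 'rV[R]_n :=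
  if t is t'.+1 then f (trajectory t' x u, u`_t') else x.

Definition admissible (N : nat) (x : 'rV[R]_n) : set (N.-tuple 'rV[R]_m) :=
  [set u | forall t, (t < N)%N -> Z (trajectory t x u, u`_t)].

Definition total_cost (N : nat) (x : 'rV[R]_n) (u : N.-tuple 'rV[R]_m) : R :=
  \sum_(t < N) l (trajectory t x u, u`_t).

Definition uniform_incremental_controllability_continuous_in_cost
    (X : set 'rV[R]_n) : Prop :=
  exists (N : nat) (delta : R -> R), class_Kinfty delta /\
    forall x1 x2, X x1 -> X x2 ->
    forall u1 : N.-tuple 'rV[R]_m, admissible x1 u1 ->
    exists u2 : N.-tuple 'rV[R]_m,
      [/\ admissible x2 u2,
          trajectory N x1 u1 = trajectory N x2 u2
        & `|total_cost x1 u1 - total_cost x2 u2|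
            <= delta (euclidean_norm (x1 - x2))].

End ControlSystem.

(* Main.v *)
Require Import Defs.
From HB Require Import structures.
From mathcomp Require Import all_boot all_order all_algebra.
From mathcomp Require Import all_classical all_reals all_analysis.
From mathcomp Require Import ring lra.

(** Write T for the Bellman operator.  Iterating the one-step optimality of T
    gives the dynamic programming principle: for every N, T^N phi x is the
    minimum, over the admissible inputs u of length N, of the cost of u plus
    phi at the state reached (iter_bellman_le for the lower bound,
    iter_bellman_attained for the existence of a minimizer).

    Let N and delta come from the controllability assumption, and let N <= k,
    so that T^k psi = T^N (T^(k - N) psi).  An optimal input for x2 is matched
    by an input from x1 which reaches the same state, hence pays the same
    terminal value T^(k - N) psi, and whose cost differs by at most
    delta (|x1 - x2|).  Exchanging x1 and x2, delta is a common modulus of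
    continuity of all the T^k psi with N <= k, whatever k is.

    Only the finitely many iterates with k < N remain.  Each is continuous on
    the compact set X, hence has a class K-infinity modulus of continuity, and
    the sum of delta and of these moduli serves for the whole sequence.  The
    modulus of a single function is obtained in two steps: on a compact set,
    the oscillation is below e + c |x - y| for every e > 0 and a suitable c
    (compact_affine_modulus), and the infimum of all such affine bounds, plus
    the identity, is of class K-infinity (class_Kinfty_majorant). *)

Set Implicit Arguments.
Unset Strict Implicit.
Unset Printing Implicit Defensive.

Import Order.TTheory GRing.Theory Num.Theory.
Import numFieldNormedType.Exports.

Local Open Scope classical_set_scope.
Local Open Scope ring_scope.

(** * Functions of class K-infinity *)

Section Kinfty.
Context {R : realType}.

Lemma class_Kinfty_ge0 (g : R -> R) s : class_Kinfty g -> 0 <= s -> 0 <= g s.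
Proof.
move=> [g0 _ _ _ _] s0; have := g0 s.
by rewrite /= !in_itv /= !andbT; exact.
Qed.

Lemma class_KinftyD (g h : R -> R) :
  class_Kinfty g -> class_Kinfty h -> class_Kinfty (g \+ h).
Proof.
move=> gK hK; have [g0 gc gm gu gz] := gK; have [h0 hc hm hu hz] := hK.
have itv0 (s : R) : (`[0, +oo[%classic : set R) s = (0 <= s).
  by rewrite /= in_itv /= andbT.
split.
- by move=> s; rewrite !itv0 => s0; rewrite addr_ge0 ?class_Kinfty_ge0.
- exact: within_continuousD.
- by move=> s t ps pt st; rewrite /= ltrD ?gm ?hm.
- move=> M; have [s s0 Ms] := gu M; exists s => //=.
  by rewrite ltr_wpDr ?class_Kinfty_ge0.
- by rewrite /= gz hz addr0.
Qed.

(** A set P of pairs (distance, oscillation) whose oscillations are bounded by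
    e + c * distance, with e arbitrarily small, lies below the graph of a
    class K-infinity function.  The infimum of these affine bounds is
    subadditive, so that its continuity everywhere reduces to its continuity
    at 0, where it is as small as e. *)
Section Modulus.
Variable P : set (R * R).
Hypothesis P_dist : forall p, P p -> 0 <= p.1.
Hypothesis P_affine : forall e, 0 < e ->
  exists2 c, 0 <= c & forall p, P p -> p.2 <= e + c * p.1.

Let majorant : set (R * R) := [set ac |
  [/\ 0 <= ac.1, 0 <= ac.2 & forall p, P p -> p.2 <= ac.1 + ac.2 * p.1]].

Let values (s : R) : set R := [set ac.1 + ac.2 * `|s| | ac in majorant].

(* The absolute value makes omega an even function on the whole line; thus its
   continuity can be proved on R rather than within the half-line. *)
Let omega (s : R) : R := inf (values s).

Let values_neq0 s : values s !=set0.
Proof.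
have [c c0 Pc] := P_affine ltr01.
by exists (1 + c * `|s|), (1, c) => //; split=> //=.
Qed.

Let values_ge0 s : lbound (values s) 0.
Proof. by move=> _ [[a c] [/= a0 c0 _] <-]; rewrite addr_ge0 ?mulr_ge0. Qed.

Let omega_ge0 s : 0 <= omega s.
Proof. exact/lb_le_inf. Qed.

Let omega_le s ac : majorant ac -> omega s <= ac.1 + ac.2 * `|s|.
Proof. by move=> h; apply: ge_inf; [exists 0; exact: values_ge0|exists ac]. Qed.

Let omega_homo s t : 0 <= s -> s <= t -> omega s <= omega t.
Proof.
move=> s0 st; apply: lb_le_inf => // _ [ac h <-].
apply: le_trans (omega_le s h) _; case: h => a0 c0 _.
by rewrite lerD2l ler_wpM2l// !ger0_norm// (le_trans s0).
Qed.

Let omega_subadditive s t : omega s <= omega t + omega (s - t).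
Proof.
rewrite -lerBlDr; apply: lb_le_inf => // _ [[a c] h <-].
rewrite lerBlDr -lerBlDl; apply: lb_le_inf => // _ [[b d] k <-] /=.
rewrite lerBlDl.
have tri : `|s| <= `|t| + `|s - t| by rewrite -{1}(subrKC t s) ler_normD.
have [a0 c0 _] := h; have [b0 d0 _] := k; rewrite /= in a0 c0 b0 d0.
(* Of the two affine bounds, the one with the smaller slope bounds omega s. *)
have [cd|/ltW dc] := leP c d.
  apply: le_trans (omega_le s h) _ => /=.
  have := ler_wpM2l c0 tri; have := ler_wpM2r (normr_ge0 (s - t)) cd.
  by rewrite mulrDr; lra.
apply: le_trans (omega_le s k) _ => /=.
have := ler_wpM2l d0 tri; have := ler_wpM2r (normr_ge0 t) dc.
by rewrite mulrDr; lra.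
Qed.

Let omega_small e : 0 < e ->
  exists2 c, 0 <= c & forall s, omega s <= e + c * `|s|.
Proof.
move=> e0; have [c c0 Pc] := P_affine e0.
by exists c => // s; apply: (omega_le s (ac := (e, c))); split=> //=; exact: ltW.
Qed.

Let omega0 : omega 0 = 0.
Proof.
apply/eqP; rewrite eq_le omega_ge0 andbT; apply/ler_addgt0Pr => e e0.
have [c _ /(_ 0)] := omega_small e0.
by rewrite normr0 mulr0 addr0 add0r.
Qed.

Let omega_continuous : continuous omega.
Proof.
move=> t; apply/cvgrPdist_le => e e0.
have e2 : 0 < e / 2 by rewrite divr_gt0.
have [c c0 hc] := omega_small e2.
have c1 : 0 < c + 1 by rewrite ltr_wpDl.
near=> s.
have st : `|t - s| < e / 2 / (c + 1).
  near: s; have /cvgrPdist_lt := @cvg_id _ (nbhs t).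
  by apply; rewrite divr_gt0.
have {}st : c * `|t - s| <= e / 2.
  apply: (@le_trans _ _ ((c + 1) * `|t - s|)).
    by rewrite ler_wpM2r// lerDl.
  by rewrite mulrC -ler_pdivlMr// ltW.
have h1 := omega_subadditive t s; have h2 := omega_subadditive s t.
have k1 := hc (t - s); have k2 := hc (s - t).
rewrite distrC in k2; rewrite distrC.
by rewrite ler_norml; apply/andP; split; lra.
Unshelve. all: by end_near. Qed.

Lemma class_Kinfty_majorant :
  exists2 gamma : R -> R, class_Kinfty gamma &
    forall p, P p -> p.2 <= gamma p.1.
Proof.
have itv0 (s : R) : (`[0, +oo[%classic : set R) s = (0 <= s).
  by rewrite /= in_itv /= andbT.
(* omega may be bounded or locally constant; adding the identity makes it
   strictly increasing and unbounded. *)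
exists (fun s => omega s + s); last first.
  move=> p Pp; have p0 := P_dist Pp.
  apply: (@le_trans _ _ (omega p.1)); last by rewrite lerDl.
  apply: lb_le_inf => // _ [ac [_ _ +] <-].
  by rewrite (ger0_norm p0); exact.
split.
- by move=> s; rewrite !itv0 => s0; rewrite addr_ge0.
- apply: continuous_subspaceT => s.
  by apply: cvgD; [exact: omega_continuous|exact: cvg_id].
- move=> s t; rewrite !in_itv /= !andbT => s0 _ st.
  by rewrite ler_ltD// omega_homo// ltW.
- move=> M; exists (`|M| + 1); first by rewrite addr_ge0.
  rewrite ltr_wpDl// (le_lt_trans (ler_norm M))// ltrDl//.
- by rewrite omega0 addr0.
Qed.

End Modulus.
End Kinfty.

(** * Moduli of continuity on a compact set *)

Lemma euclidean_norm_distC (R : realType) (n : nat) (x y : 'rV[R]_n) :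
  euclidean_norm (x - y) = euclidean_norm (y - x).
Proof.
by congr Num.sqrt; apply: eq_bigr => i _; rewrite -opprB mxE sqrrN.
Qed.

Lemma norm_le_euclidean_norm (R : realType) (n : nat) (x : 'rV[R]_n) :
  `|x| <= euclidean_norm x.
Proof.
rewrite [leLHS]/Num.norm /= mx_normrE; apply/bigmax_leP.
split=> [|[i j] _ /=]; first exact: sqrtr_ge0.
rewrite (ord1 i) /euclidean_norm -sqrtr_sqr ler_sqrt; last first.
  by apply: sumr_ge0 => k _; exact: sqr_ge0.
by rewrite (bigD1 j) //= lerDl sumr_ge0// => k _; exact: sqr_ge0.
Qed.

(** Compactness of X * X makes a local slope bound uniform.  For p in X * X
    near (x, y), g p.1 and g p.2 are within e / 2 of g x and g y, so it is
    enough that |g x - g y| <= c |p.1 - p.2|: this is trivial if x = y, and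
    otherwise it holds for large c because |p.1 - p.2| stays above
    |x - y| / 2. *)
Lemma compact_affine_modulus (R : realType) (V : normedModType R) (X : set V)
    (g : V -> R) :
  compact X -> {within X, continuous g} ->
  forall e, 0 < e -> exists2 c, 0 <= c &
    forall x y, X x -> X y -> `|g x - g y| <= e + c * `|x - y|.
Proof.
move=> Xc gc e e0.
have /compact_near_coveringP/near_covering_withinP cov := compact_setX Xc Xc.
have : \forall c \near +oo%R, X `*` X `<=`
    (fun p => `|g p.1 - g p.2| <= e + c * `|p.1 - p.2|).
  apply: cov => -[x y] /= [Xx Xy].
  have e2 : 0 < e / 2 by rewrite divr_gt0.
  move/subspace_continuousP: gc => gc.
  have nb z : X z -> \forall z' \near z, X z' -> `|g z - g z'| < e / 2.
    by move=> Xz; have /cvgrPdist_lt/(_ _ e2) := gc _ Xz.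
  have far : \forall p \near (x, y) & c \near +oo%R,
      `|g x - g y| <= c * `|p.1 - p.2|.
    have large (r : R) : \forall p \near (x, y) & c \near +oo%R, r <= c.
      have rc : \forall c \near +oo%R, r <= c.
        exact: nbhs_pinfty_ge (num_real r).
      exact: (cvg_snd rc).
    have [xy|xy] := eqVneq x y.
      apply: filterS (large 0) => -[p c] /= c0.
      by rewrite xy subrr normr0 mulr_ge0.
    have d0 : 0 < `|x - y| by rewrite normr_gt0 subr_eq0.
    have dist_cvg : `|p.1 - p.2| @[p --> (x, y)] --> `|x - y|.
      by apply: cvg_norm; apply: cvgB; [exact: cvg_fst|exact: cvg_snd].
    have half : \forall p \near (x, y), `|x - y| / 2 < `|p.1 - p.2|.
      by apply: (cvgr_gt _ dist_cvg); lra.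
    have {}half : \forall p \near (x, y) & c \near (+oo%R : set_system R),
        `|x - y| / 2 < `|p.1 - p.2|.
      exact: (cvg_fst half).
    apply: filterS2 half (large (`|g x - g y| / (`|x - y| / 2))).
    move=> -[p c] /= half c_ge.
    apply: (@le_trans _ _ (c * (`|x - y| / 2))).
      by rewrite -ler_pdivrMr ?divr_gt0.
    by rewrite ler_wpM2l ?(le_trans _ c_ge) ?divr_ge0// ltW.
  have close : \forall p \near (x, y) & c \near (+oo%R : set_system R),
      (X `*` X) p -> `|g x - g p.1| < e / 2 /\ `|g y - g p.2| < e / 2.
    have closex : \forall p \near (x, y), X p.1 -> `|g x - g p.1| < e / 2.
      exact: (cvg_fst (nb x Xx)).
    have closey : \forall p \near (x, y), X p.2 -> `|g y - g p.2| < e / 2.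
      exact: (cvg_snd (nb y Xy)).
    have closexy : \forall p \near (x, y), (X `*` X) p ->
        `|g x - g p.1| < e / 2 /\ `|g y - g p.2| < e / 2.
      by apply: filterS2 closex closey => p le_x le_y [/le_x ? /le_y].
    exact: (cvg_fst closexy).
  apply: filterS2 far close => -[p c] /= le_xy /[apply] -[le_x le_y].
  have : `|g p.1 - g p.2| <= `|g x - g p.1| + `|g x - g y| + `|g y - g p.2|.
    rewrite (_ : g p.1 - g p.2 = - (g x - g p.1) + (g x - g y) + (g y - g p.2)).
      rewrite (le_trans (ler_normD _ _))// lerD2r.
      by rewrite -(normrN (g x - g p.1)) ler_normD.
    by ring.
  by lra.
move=> h.
near (+oo%R : set_system R) => c.
exists c; first by near: c; exact: nbhs_pinfty_ge.
move=> x y Xx Xy.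
have : X `*` X `<=` (fun p => `|g p.1 - g p.2| <= e + c * `|p.1 - p.2|).
  by near: c.
by move=> /(_ (x, y)); apply.
Unshelve. all: by end_near. Qed.

(** * Dynamic programming *)

Lemma within_continuous_comp_set (T U V : topologicalType) (A : set T)
    (B : set U) (f : T -> U) (g : U -> V) :
  set_fun A B f -> {within A, continuous f} -> {within B, continuous g} ->
  {within A, continuous (g \o f)}.
Proof.
move=> AB /subspace_continuousP fc /subspace_continuousP gc.
apply/subspace_continuousP => x Ax.
apply: cvg_comp (gc _ (AB _ Ax)) => W.
rewrite {1}/within /= => nW; have := fc _ Ax _ nW.
rewrite /nbhs /= /within /=; apply: filterS => y h Ay.
by apply: h => //; exact: AB.
Qed.

Lemma minimumP (R : realType) (A : set R) :
  (exists2 a, A a & lbound A a) -> A (minimum A) /\ lbound A (minimum A).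
Proof.
by move=> [a Aa la]; apply: (@xgetPex _ 0 (A `&` lbound A)); exists a.
Qed.

Section DynamicProgramming.
Context {R : realType} {n m : nat}.
Variables (X : set 'rV[R]_n) (Z : set ('rV[R]_n * 'rV[R]_m)).
Variables (f : 'rV[R]_n * 'rV[R]_m -> 'rV[R]_n).
Variables (l : 'rV[R]_n * 'rV[R]_m -> R).
Hypothesis Z_compact : compact Z.
Hypothesis f_fun : set_fun Z X f.
Hypothesis f_continuous : {within Z, continuous f}.
Hypothesis l_continuous : {within Z, continuous l}.
Hypothesis inputs_nonempty : forall x, X x -> inputs Z x !=set0.
Hypothesis bellman_continuous : forall psi : 'rV[R]_n -> R,
  {within X, continuous psi} -> {within X, continuous (bellman Z f l psi)}.

(** The minimum that defines the Bellman operator is a true one: the cost to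
    minimize is continuous on the fibre of Z over x, which is nonempty, and
    compact because it is closed in the compact set Z. *)
Lemma bellman_optimal (psi : 'rV[R]_n -> R) (x : 'rV[R]_n) :
    {within X, continuous psi} -> X x ->
  (exists2 u, Z (x, u) & bellman Z f l psi x = l (x, u) + psi (f (x, u))) /\
  (forall u, Z (x, u) -> bellman Z f l psi x <= l (x, u) + psi (f (x, u))).
Proof.
move=> psic Xx.
pose Zx := Z `&` fst @^-1` [set x].
pose h := l \+ (psi \o f).
have Zx_compact : compact Zx.
  apply: compact_closedI => //; apply: closed_comp.
    by move=> p _; exact: cvg_fst.
  exact: accessible_closed_set1 (hausdorff_accessible (@norm_hausdorff _ _)) _.
have Zx0 : Zx !=set0 by have [u Zu] := inputs_nonempty Xx; exists (x, u).
have hc : {within Zx, continuous h}.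
  apply: (@continuous_subspaceW _ _ _ Z); first by move=> ? [].
  apply: within_continuousD => //.
  exact: within_continuous_comp_set psic.
have [[x' u] /set_mem[/= Zu xx'] hmin] := compact_EVT_min Zx0 Zx_compact hc.
rewrite /= in xx'; subst x'.
have [[v Zv <-] vmin] : [set l (x, u) + psi (f (x, u)) | u in inputs Z x]
    (bellman Z f l psi x) /\
    lbound [set l (x, u) + psi (f (x, u)) | u in inputs Z x]
    (bellman Z f l psi x).
  apply: minimumP; exists (h (x, u)); first by exists u.
  by move=> _ [v Zv <-]; apply: (hmin (x, v)); apply/mem_set.
split; first by exists v.
by move=> w Zw; apply: vmin; exists w.
Qed.

Lemma iter_bellman_continuous (psi : 'rV[R]_n -> R) k :
  {within X, continuous psi} ->
  {within X, continuous (iter k (bellman Z f l) psi)}.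
Proof. by move=> psic; elim: k => //= k; exact: bellman_continuous. Qed.

(** Admissibility for sequences of any length, so that an input of length
    N + 1 is also one of length N without truncating it. *)
Definition admissible_seq (N : nat) (x : 'rV[R]_n) (u : seq 'rV[R]_m) :=
  forall t, (t < N)%N -> Z (trajectory f t x u, u`_t).

Lemma trajectory_in N x u :
  X x -> admissible_seq N x u -> X (trajectory f N x u).
Proof. by case: N => //= N _ /(_ N (leqnn _)) /f_fun. Qed.

(** The trajectory grows at its end, so the induction on N peels off the
    innermost T: the induction hypothesis is used for T psi, whose value at the
    state reached after N steps pays for the last step. *)
Lemma iter_bellman_le (psi : 'rV[R]_n -> R) N x u :
    {within X, continuous psi} -> X x -> admissible_seq N x u ->
  iter N (bellman Z f l) psi x <=
    \sum_(t < N) l (trajectory f t x u, u`_t) + psi (trajectory f N x u).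
Proof.
move=> + Xx; elim: N psi => [|N IH] psi psic adm.
  by rewrite big_ord0 add0r.
have admN : admissible_seq N x u by move=> t tN; apply: adm; exact: ltnW.
rewrite iterSr (le_trans (IH _ (bellman_continuous psic) admN))//.
rewrite big_ord_recr /= -addrA lerD2l.
have [_] := bellman_optimal psic (trajectory_in Xx admN).
by apply; exact: adm.
Qed.

Lemma trajectory_rcons t x (u : seq 'rV[R]_m) v :
  (t <= size u)%N -> trajectory f t x (rcons u v) = trajectory f t x u.
Proof.
by elim: t => //= t IH tu; rewrite IH 1?ltnW// nth_rcons tu.
Qed.

Lemma iter_bellman_attained (psi : 'rV[R]_n -> R) N x :
    {within X, continuous psi} -> X x ->
  exists u : N.-tuple 'rV[R]_m, admissible_seq N x u /\
    iter N (bellman Z f l) psi x =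
      \sum_(t < N) l (trajectory f t x u, u`_t) + psi (trajectory f N x u).
Proof.
move=> + Xx; elim: N psi => [|N IH] psi psic.
  by exists [tuple]; split => //; rewrite big_ord0 add0r.
have [u [adm E]] := IH _ (bellman_continuous psic).
have [[v Zv Ev] _] := bellman_optimal psic (trajectory_in Xx adm).
have trE t : (t <= N)%N -> trajectory f t x (rcons u v) = trajectory f t x u.
  by move=> tN; rewrite trajectory_rcons// size_tuple.
have nthE t : (t < N)%N -> (rcons u v)`_t = u`_t.
  by move=> tN; rewrite nth_rcons size_tuple tN.
have nthN : (rcons u v)`_N = v by rewrite nth_rcons size_tuple ltnn eqxx.
exists [tuple of rcons u v]; split=> [t|].
  rewrite ltnS leq_eqVlt => /predU1P[->|tN] /=.
    by rewrite trE// nthN.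
  by rewrite trE 1?ltnW// nthE//; exact: adm.
rewrite iterSr E Ev big_ord_recr /= trE// nthN addrA; congr (_ + _ + _).
by apply: eq_bigr => i _; rewrite trE 1?ltnW// nthE.
Qed.

End DynamicProgramming.

(** * Equicontinuity *)

Theorem proposition5p9 (R : realType) (n m : nat)
    (X : set 'rV[R]_n) (Z : set ('rV[R]_n * 'rV[R]_m))
    (f : 'rV[R]_n * 'rV[R]_m -> 'rV[R]_n) (l : 'rV[R]_n * 'rV[R]_m -> R)
    (X_nonempty : X !=set0)
    (X_compact : compact X)
    (Z_sub : Z `<=` X `*` setT)
    (Z_compact : compact Z)
    (f_fun : set_fun Z X f)
    (f_continuous : {within Z, continuous f})
    (l_continuous : {within Z, continuous l})
    (inputs_nonempty : forall x, X x -> inputs Z x !=set0)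
    (inputs_usc : upper_semicontinuous_on X (inputs Z))
    (bellman_continuous : forall psi : 'rV[R]_n -> R,
      {within X, continuous psi} -> {within X, continuous (bellman Z f l psi)})
    (controllable :
      uniform_incremental_controllability_continuous_in_cost Z f l X)
    (psi : 'rV[R]_n -> R)
    (psi_continuous : {within X, continuous psi}) :
  equicontinuous_seq X (fun k => iter k (bellman Z f l) psi).
Proof.
have [N [delta [deltaK ctrl]]] := controllable.
set T := bellman Z f l.
have Tc k : {within X, continuous (iter k T psi)}.
  exact: iter_bellman_continuous.
have tail k x1 x2 : (N <= k)%N -> X x1 -> X x2 ->
    iter k T psi x1 - iter k T psi x2 <= delta (euclidean_norm (x1 - x2)).
  move=> /subnKC <- X1 X2; rewrite iterD.
  (* A bound on T^k psi x1 from above needs an arbitrary input from x1 but an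
     optimal one from x2, so controllability is applied from x2 to x1. *)
  have [u2 [adm2 ->]] := iter_bellman_attained Z_compact f_fun
    f_continuous l_continuous inputs_nonempty bellman_continuous
    N (Tc (k - N)%N) X2.
  have [u1 [adm1 trE costE]] := ctrl _ _ X2 X1 u2 adm2.
  have := iter_bellman_le Z_compact f_fun f_continuous l_continuous
    inputs_nonempty bellman_continuous (Tc (k - N)%N) X1 adm1.
  rewrite -trE euclidean_norm_distC.
  move: costE; rewrite distrC /total_cost => /(le_trans (ler_norm _)).
  lra.
(* A majorant of delta which is also a modulus of the first N iterates. *)
suff [gamma [gammaK delta_le head]] : exists gamma, [/\ class_Kinfty gamma,
    forall s, 0 <= s -> delta s <= gamma s &
    forall k x1 x2, (k < N)%N -> X x1 -> X x2 ->
      `|iter k T psi x1 - iter k T psi x2| <= gamma (euclidean_norm (x1 - x2))].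
  exists gamma => // k x1 x2 X1 X2.
  have [kN|Nk] := ltnP k N; first exact: head.
  apply: le_trans (delta_le (euclidean_norm (x1 - x2)) (sqrtr_ge0 _)).
  rewrite ler_norml lerNl opprB tail// andbT euclidean_norm_distC.
  exact: tail.
elim: N {ctrl tail} => [|M [gamma [gammaK delta_le head]]].
  by exists delta; split.
pose P := [set p : R * R | exists x1 x2, [/\ X x1, X x2,
  p.1 = euclidean_norm (x1 - x2) & p.2 = `|iter M T psi x1 - iter M T psi x2|]].
have [||eta etaK eta_ge] := @class_Kinfty_majorant _ P.
- by move=> _ [x1 [x2 [_ _ -> _]]]; exact: sqrtr_ge0.
- move=> e e0; have [c c0 hc] := compact_affine_modulus X_compact (Tc M) e0.
  exists c => // _ [x1 [x2 [X1 X2 -> ->]]].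
  apply: le_trans (hc _ _ X1 X2) _.
  by rewrite lerD2l ler_wpM2l// norm_le_euclidean_norm.
exists (gamma \+ eta); split; first exact: class_KinftyD.
  by move=> s s0; rewrite (le_trans (delta_le s s0))// lerDl class_Kinfty_ge0.
move=> k x1 x2; rewrite ltnS leq_eqVlt => /predU1P[->|kM] X1 X2 /=.
  apply: (@le_trans _ _ (eta (euclidean_norm (x1 - x2)))).
    by apply: (eta_ge (_, _)); exists x1, x2.
  by rewrite lerDr class_Kinfty_ge0// sqrtr_ge0.
by rewrite (le_trans (head _ _ _ kM X1 X2))// lerDl class_Kinfty_ge0// sqrtr_ge0.
Qed.
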